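(* Let $N\ge2$ be an integer. For $n=1,\dots,N$, $j=1,2,3,4$, let $z_{n,j}(\theta)$ be analytic functions on simply connected open sets $V_j\subset\mathbb C$ satisfying $\det\mathbf A(z_{n,j}(\theta),\theta)=0$ for $\theta\in V_j$. Let $\theta\in(0,2\pi)\cap\bigcap_jV_j$ be such that $\operatorname{Re}z_{n,j}(\theta)>-1$ and $z_{n,j}(\theta)\notin\mathbb Z$ for all $n,j$, and let $\mathbf p^{n,j}=(p^{n,j}_1,p^{n,j}_2,p^{n,j}_3,p^{n,j}_4)^\top\in\ker\mathbf A(z_{n,j}(\theta),\theta)$. Suppose the density $\phi$ on the wedge satisfies $$[\phi_1(t),\phi_2(t),\phi_1(-t),\phi_2(-t)]^\top=\sum_{n=1}^N\sum_{j=1}^4\alpha_{n,j}\,\mathbf p^{n,j}\,t^{z_{n,j}},\qquad 0<t<1,$$ where $\boldsymbol\alpha_n=(\alpha_{n,1},\dots,\alpha_{n,4})^\top\in\mathbb C^4$. Let $h=-\frac12\phi+\mathcal D[\phi]$ and $\tilde h(t)=[h_1(t),h_2(t),h_1(-t),h_2(-t)]^\top$. Then $$\tilde h(t)=\sum_{k=0}^{N-1}\boldsymbol\beta_kt^k+O(t^N),\qquad 0<t<1,$$ where $\boldsymbol\beta_k\in\mathbb C^4$ are given by $$\begin{bmatrix}\boldsymbol\beta_0\\\vdots\\\boldsymbol\beta_{N-1}\end{bmatrix}=\begin{bmatrix}\mathbf B_{0,1}(\theta)&\cdots&\mathbf B_{0,N}(\theta)\\\vdots&\ddots&\vdots\\\mathbf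 B_{N-1,1}(\theta)&\cdots&\mathbf B_{N-1,N}(\theta)\end{bmatrix}\begin{bmatrix}\boldsymbol\alpha_1\\\vdots\\\boldsymbol\alpha_N\end{bmatrix},$$ with $4\times4$ blocks $$\mathbf B_{k,n}(\theta)=\left[\mathbf F(k,z_{n,1}(\theta),\theta)\mathbf p^{n,1}\,\middle|\,\cdots\,\middle|\,\mathbf F(k,z_{n,4}(\theta),\theta)\mathbf p^{n,4}\right].$$
   Context: $\lambda,\mu$ are real constants with $\mu>0$, $\lambda+\mu>0$. The wedge $\Gamma=OA\cup OB$ with opening angle $\theta$ is parameterized by arclength: $\gamma(t)=(t,0)$ for $0\le t\le1$ (edge $OA$), $\gamma(t)=(-t\cos\theta,-t\sin\theta)$ for $-1\le t\le0$ (edge $OB$). Unit tangents/normals: $\tau=(1,0)$, $n=(0,-1)$ on $OA$; $\tau=(-\cos\theta,-\sin\theta)$, $n=(-\sin\theta,\cos\theta)$ on $OB$. Functions on $\Gamma$ are written as functions of $t\in[-1,1]$. With $r=x-y$, $|r|$ its norm, $\mathbf L=\begin{bmatrix}0&1\\-1&0\end{bmatrix}$, the kernel is $$\mathbf D(x,y)=\frac{\mu}{\lambda+2\mu}\left[\frac{n(y)\cdot r}{2\pi|r|^2}\mathbf I+\frac{\tau(y)\cdot r}{2\pi|r|^2}\mathbf L\right]+\frac{\lambda+\mu}{\lambda+2\mu}\frac{(n(y)\cdot r)\,r\otimes r}{\pi|r|^4},$$ and $\mathcal D[\phi](t)=\mathrm{p.v.}\int_\Gamma\mathbf D(\gamma(t),y)\phi(y)\,ds_y$.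 For $t>0$, $t^z=e^{z\ln t}$ with $\ln t$ real. Definition of $\mathbf A$ and $\mathbf F$: for $z\notin\mathbb Z$, $\operatorname{Re}z>-1$, the density with $[\phi_1(t),\phi_2(t),\phi_1(-t),\phi_2(-t)]^\top=\mathbf p\,t^z$, $\mathbf p\in\mathbb C^4$, gives $\tilde h(t)=\left[\mathbf A(z,\theta)t^z+\sum_{k\ge0}\mathbf F(k,z,\theta)t^k\right]\mathbf p$ for $0<t<1$, and $\mathbf A(z,\theta)$, $\mathbf F(k,z,\theta)$ are the $4\times4$ matrices (independent of $t$ and $\mathbf p$) in this expansion. Explicitly, with $c_1=\frac{\mu}{2(\lambda+2\mu)}$, $c_2=\frac{\lambda+\mu}{\lambda+2\mu}$, $S=\sin(z(\pi-\theta))$, $C=\cos(z(\pi-\theta))$, $q=\csc(\pi z)$, the columns of $\mathbf A(z,\theta)$ (also for complex $\theta$) are $$\mathbf A_1=\begin{bmatrix}-\frac12\\-c_1\cot(\pi z)\\-c_1qS+\frac14c_2q[-(z+2)S+z\sin(\pi z-(z-2)\theta)]\\-c_1qC+\frac12c_2zq\sin\theta\sin(\pi z-(z-1)\theta)\end{bmatrix},$$ $$\mathbf A_2=\begin{bmatrix}c_1\cot(\pi z)\\-\frac12\\c_1qC+\frac12c_2zq\sin\theta\sin(\pi z-(z-1)\theta)\\-c_1qS+\frac14c_2q[(z-2)S-z\sin(\pi z-(z-2)\theta)]\end{bmatrix},$$ $$\mathbf A_3=\begin{bmatrix}-c_1qS+\frac14c_2q[(z-2)S-z\sin(\pi z-(z+2)\theta)]\\c_1qC-\frac12c_2zq\sin\theta\sin(\pi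 z-(z+1)\theta)\\-\frac12\\c_1\cot(\pi z)\end{bmatrix},$$ $$\mathbf A_4=\begin{bmatrix}-c_1qC-\frac12c_2zq\sin\theta\sin(\pi z-(z+1)\theta)\\-c_1qS+\frac14c_2q[-(z+2)S+z\sin(\pi z-(z+2)\theta)]\\-c_1\cot(\pi z)\\-\frac12\end{bmatrix}.$$ *)

(* Defs.v *)
From HB Require Import structures.
From mathcomp Require Import all_boot all_order all_algebra.
From mathcomp Require Import all_classical all_reals all_analysis.
From mathcomp Require Export complex.

Set Implicit Arguments.
Unset Strict Implicit.
Unset Printing Implicit Defensive.
Import Order.TTheory GRing.Theory Num.Theory.
Import numFieldNormedType.Exports.
Local Open Scope classical_set_scope.
Local Open Scope ring_scope.
Local Open Scope complex_scope.

Section ComplexFunctions.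
Context {R : realType}.
Implicit Types z w : R[i].

Definition cexp z : R[i] :=
  (expR (complex.Re z))%:C * (cos (complex.Im z) +i* sin (complex.Im z)).
Definition csin z : R[i] := (cexp ('i * z) - cexp (- ('i * z))) / (2 * 'i).
Definition ccos z : R[i] := (cexp ('i * z) + cexp (- ('i * z))) / 2.
Definition ccot z : R[i] := ccos z / csin z.
Definition ccsc z : R[i] := (csin z)^-1.

(* Only meant for t > 0. *)
Definition cpow (t : R) z : R[i] := cexp (z * (ln t)%:C).

Definition is_integer z : Prop := exists m : int, z = m%:~R.

(* R[i]^o carries the metric topology of the complex plane. *)
Definition analytic_on (V : set R[i]^o) (f : R[i] -> R[i]) : Prop :=
  forall w0 : R[i]^o, V w0 -> exists a : nat -> R[i],
    \forall w \near w0,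
      (fun m => \sum_(0 <= k < m) a k * (w - w0) ^+ k : R[i]^o) @ \oo
        --> (f w : R[i]^o).

Definition path_connected (T : topologicalType) (V : set T) : Prop :=
  forall x y, V x -> V y -> exists g : R -> T,
    [/\ {within `[0, 1], continuous g},
        forall s, s \in `[0, 1] -> V (g s), g 0 = x & g 1 = y].

Definition simply_connected (T : topologicalType) (V : set T) : Prop :=
  path_connected V /\
  forall g : R -> T,
    {within `[0, 1], continuous g} ->
    (forall s, s \in `[0, 1] -> V (g s)) -> g 0 = g 1 ->
  exists H : R * R -> T,
    [/\ {within `[0, 1] `*` `[0, 1], continuous H},
        forall u s, u \in `[0, 1] -> s \in `[0, 1] -> V (H (u, s)),
        forall s, s \in `[0, 1] -> H (0, s) = g s /\ H (1, s) = g 0 &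
        forall u, u \in `[0, 1] -> H (u, 0) = g 0 /\ H (u, 1) = g 0].

End ComplexFunctions.
Arguments simply_connected R {T} V.

Section Wedge.
Context {R : realType}.
Local Notation C := R[i].

Definition vec2 (a b : R) : 'cV[R]_2 := \col_i (if i == 0 then a else b).

Definition dotp (u v : 'cV[R]_2) : R := \sum_i u i 0 * v i 0.

Definition wedge_point (theta t : R) : 'cV[R]_2 :=
  if 0 <= t then vec2 t 0 else vec2 (- t * cos theta) (- t * sin theta).
Definition wedge_tangent (theta t : R) : 'cV[R]_2 :=
  if 0 <= t then vec2 1 0 else vec2 (- cos theta) (- sin theta).
Definition wedge_normal (theta t : R) : 'cV[R]_2 :=
  if 0 <= t then vec2 0 (-1) else vec2 (- sin theta) (cos theta).

Definition Lmx : 'M[R]_2 := delta_mx 0 1 - delta_mx 1 0.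

Definition elastic_kernel (lambda mu : R) (tau n x y : 'cV[R]_2) : 'M[R]_2 :=
  let r := x - y in
  let r2 := dotp r r in
  (mu / (lambda + 2 * mu)) *:
    ((dotp n r / (2 * pi * r2)) *: 1%:M + (dotp tau r / (2 * pi * r2)) *: Lmx)
  + ((lambda + mu) / (lambda + 2 * mu) * (dotp n r / (pi * r2 ^+ 2))) *:
    (r *m r^T).

Definition wedge_integrand (lambda mu theta : R) (phi : R -> 'cV[C]_2)
    (t s : R) : 'cV[C]_2 :=
  map_mx (real_complex R)
    (elastic_kernel lambda mu (wedge_tangent theta s) (wedge_normal theta s)
       (wedge_point theta t) (wedge_point theta s)) *m phi s.

(* Parameters of the points of the wedge at distance > e from the target;
   as the parameterization is by arclength, ds_y is Lebesgue measure ds. *)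
Definition wedge_away (theta t e : R) : set R :=
  let d s := wedge_point theta t - wedge_point theta s in
  [set s | s \in `[-1, 1] /\ e < Num.sqrt (dotp (d s) (d s))].

Definition trunc_int (theta t : R) (f : R -> R) (e : R) : R :=
  (\int[lebesgue_measure]_(s in wedge_away theta t e) f s)%R.

Definition pv_exists (theta t : R) (f : R -> R) : Prop :=
  (forall e, 0 < e ->
    lebesgue_measure.-integrable (wedge_away theta t e) (EFin \o f)) /\
  cvg (trunc_int theta t f e @[e --> 0^'+]).

Definition pv_int (theta t : R) (f : R -> R) : R :=
  lim (trunc_int theta t f e @[e --> 0^'+]).

Definition double_layer_exists (lambda mu theta : R) (phi : R -> 'cV[C]_2)
    (t : R) : Prop :=
  forall i,
    pv_exists theta t
      (fun s => complex.Re (wedge_integrand lambda mu theta phi t s i 0))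
    /\
    pv_exists theta t
      (fun s => complex.Im (wedge_integrand lambda mu theta phi t s i 0)).

Definition double_layer (lambda mu theta : R) (phi : R -> 'cV[C]_2)
    (t : R) : 'cV[C]_2 :=
  \col_i
    (pv_int theta t
      (fun s => complex.Re (wedge_integrand lambda mu theta phi t s i 0))
     +i*
     pv_int theta t
      (fun s => complex.Im (wedge_integrand lambda mu theta phi t s i 0))).

Definition boundary_data (lambda mu theta : R) (phi : R -> 'cV[C]_2)
    (t : R) : 'cV[C]_2 :=
  - 2^-1 *: phi t + double_layer lambda mu theta phi t.

Definition stack (f : R -> 'cV[C]_2) (t : R) : 'cV[C]_4 :=
  col_mx (f t) (f (- t)).

Definition Amx (lambda mu : R) (z theta : C) : 'M[C]_4 :=
  let c1 := (mu / (2 * (lambda + 2 * mu)))%:C in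
  let c2 := ((lambda + mu) / (lambda + 2 * mu))%:C in
  let p := (pi : R)%:C in
  let S := csin (z * (p - theta)) in
  let K := ccos (z * (p - theta)) in
  let q := ccsc (p * z) in
  let A1 := [:: - 2^-1;
    - c1 * ccot (p * z);
    - c1 * q * S
      + 4^-1 * c2 * q * (- (z + 2) * S + z * csin (p * z - (z - 2) * theta));
    - c1 * q * K
      + 2^-1 * c2 * z * q * csin theta * csin (p * z - (z - 1) * theta)] in
  let A2 := [:: c1 * ccot (p * z);
    - 2^-1;
    c1 * q * K
      + 2^-1 * c2 * z * q * csin theta * csin (p * z - (z - 1) * theta);
    - c1 * q * S
      + 4^-1 * c2 * q * ((z - 2) * S - z * csin (p * z - (z - 2) * theta))] in
  let A3 := [:: - c1 * q * S
      + 4^-1 * c2 * q * ((z - 2) * S - z * csin (p * z - (z + 2) * theta));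
    c1 * q * K
      - 2^-1 * c2 * z * q * csin theta * csin (p * z - (z + 1) * theta);
    - 2^-1;
    c1 * ccot (p * z)] in
  let A4 := [:: - c1 * q * K
      - 2^-1 * c2 * z * q * csin theta * csin (p * z - (z + 1) * theta);
    - c1 * q * S
      + 4^-1 * c2 * q * (- (z + 2) * S + z * csin (p * z - (z + 2) * theta));
    - c1 * ccot (p * z);
    - 2^-1] in
  \matrix_(i, j) nth 0 (nth [::] [:: A1; A2; A3; A4] j) i.

(* The defining property of the matrices F(k,z,theta): they are the
   coefficients of the regular part of the boundary data of the densities
   p t^z.  It determines F k z for every z concerned, a convergent power series
   on (0,1) having unique coefficients. *)
Definition wedge_expansion (lambda mu theta : R) (F : nat -> C -> 'M[C]_4)
  : Prop :=
  forall z : C, -1 < complex.Re z -> ~ is_integer z ->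
  forall (p : 'cV[C]_4) (phi : R -> 'cV[C]_2),
    (forall t, 0 < t < 1 -> stack phi t = cpow t z *: p) ->
  forall t, 0 < t < 1 ->
    [/\ double_layer_exists lambda mu theta phi t,
        double_layer_exists lambda mu theta phi (- t) &
        exists2 S : 'M[C]_4,
          forall i j, (fun m => \sum_(0 <= k < m) F k z i j * (t ^+ k)%:C
                         : C^o) @ \oo --> (S i j : C^o) &
          stack (boundary_data lambda mu theta phi) t =
          (cpow t z *: Amx lambda mu z theta%:C + S) *m p].

End Wedge.

(* Main.v *)
Require Import Defs.
From HB Require Import structures.
From mathcomp Require Import all_boot all_order all_algebra.
From mathcomp Require Import all_classical all_reals all_analysis.
From mathcomp Require Import measurable_realfun.

Set Implicit Arguments.
Unset Strict Implicit.
Unset Printing Implicit Defensive.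
Import Order.TTheory GRing.Theory Num.Theory.
Import numFieldNormedType.Exports.
Local Open Scope classical_set_scope.
Local Open Scope ring_scope.
Local Open Scope complex_scope.

(** The map sending a density to its boundary data is linear, and a density
    [p t^z] with [p] in the kernel of the matrix [A(z, theta)] loses the only
    non-smooth term [A t^z p] of its data.  What is left is the power series of
    coefficients [F(k, z, theta) p], convergent on (0, 1).  A combination of
    such densities therefore has data given by the same combination of power
    series ([regular_data_ker], [regular_data_sum]).  Its first N coefficients
    are the block matrix applied to the vector of the alphas, and its remainder
    is O(t^N) on every (0, delta], delta < 1, as for any power series converging
    on (0, 1) ([power_series_tail]).

    Linearity has to be checked at the level of principal values: the truncated
    integrals are linear because each truncation keeps the integrand integrable
    on a measurable set, and then so are their limits ([pv_linear]).  Complex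
    coefficients mix real and imaginary parts, which is why
    [double_layer_linear] uses [pv_linear] twice for each part.

    The density is prescribed only on the two open edges, so it equals the
    combination of power densities up to an error living at the corner and the
    two ends.  This error is itself the density [0 t^z], [0] being in every
    kernel; [wedge_expansion] gives it zero data, so that no argument about null
    sets is needed. *)

(** * Power series over a normed field *)

Lemma cvg_linear (K : numFieldType) (a : K) (f g : nat -> K) (u v : K) :
  (fun m => f m : K^o) @ \oo --> (u : K^o) ->
  (fun m => g m : K^o) @ \oo --> (v : K^o) ->
  (fun m => a * f m + g m : K^o) @ \oo --> (a * u + v : K^o).
Proof. by move=> fu gv; apply: cvgD => //; apply: cvgMl_tmp. Qed.

Lemma cvg_lincomb (K : numFieldType) (I : finType) (a : I -> K)
    (f : I -> nat -> K) (u : I -> K) :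
  (forall i, (fun m => f i m : K^o) @ \oo --> (u i : K^o)) ->
  (fun m => \sum_i a i * f i m : K^o) @ \oo --> (\sum_i a i * u i : K^o).
Proof.
move=> fu; elim: (index_enum I) => [|i r IHr].
  by under eq_fun do rewrite big_nil; rewrite big_nil; exact: cvg_cst.
by under eq_fun do rewrite big_cons; rewrite big_cons; apply: cvg_linear.
Qed.

(** Abel's estimate: if [B] bounds the terms at some [r] in (delta, 1), then for
    [t <= delta] the k-th term is at most [B (t / r)^k], and the geometric tail
    from N on is at most [B (t / r)^N / (1 - delta / r)]. *)
Lemma power_series_tail (K : numFieldType) (a : nat -> K) (S : K -> K)
    (N : nat) :
  (forall t, 0 < t < 1 ->
     (fun m => \sum_(0 <= k < m) a k * t ^+ k : K^o) @ \oo --> (S t : K^o)) ->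
  forall delta, 0 < delta < 1 ->
  exists M, forall t, 0 < t <= delta ->
    `|S t - \sum_(0 <= k < N) a k * t ^+ k| <= M * t ^+ N.
Proof.
move=> aS delta /andP[delta0 delta1].
pose r := (delta + 1) / 2.
have deltar : delta < r by case: (midf_lt delta1).
have r1 : r < 1 by case: (midf_lt delta1).
have r0 : 0 < r := lt_trans delta0 deltar.
have r01 : 0 < r < 1 by rewrite r0.
have [B [B0 aB]] : exists B, 0 <= B /\ forall k, `|a k| * r ^+ k <= B.
  have /cvgrPdist_le/(_ 1 ltr01)[m0 _ m0P] := aS r r01.
  exists (2 + \sum_(0 <= k < m0) `|a k * r ^+ k|); split.
    by rewrite addr_ge0// sumr_ge0.
  move=> k; rewrite -[r in leLHS](gtr0_norm r0) -normrX -normrM.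
  have [km0|m0k] := ltnP k m0.
    rewrite big_mkord (bigD1 (Ordinal km0))//= addrCA lerDl.
    by rewrite addr_ge0// sumr_ge0.
  rewrite ler_wpDr ?sumr_ge0//.
  (* Past m0 a term is the difference of two remainders of norm at most 1. *)
  have -> : a k * r ^+ k = (S r - \sum_(0 <= k < k) a k * r ^+ k)
      - (S r - \sum_(0 <= k < k.+1) a k * r ^+ k).
    by rewrite big_nat_recr//= opprB [RHS]addrC subrKA addrAC subrr add0r.
  by rewrite (le_trans (ler_normB _ _))// -[2]/(1 + 1) lerD// m0P//= leqW.
pose q0 := delta / r.
have q01 : 0 < 1 - q0 by rewrite subr_gt0 ltr_pdivrMr// mul1r.
exists (B / (1 - q0) / r ^+ N) => t /andP[t0 tdelta].
have t1 : t < 1 := le_lt_trans tdelta delta1.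
have t01 : 0 < t < 1 by rewrite t0.
pose q := t / r.
have q_ge0 : 0 <= q by rewrite divr_ge0// ltW.
have qq0 : q <= q0 by rewrite ler_pM2r// invr_gt0.
(* The sum S t is approximated within e by a partial sum of order m >= N. *)
apply/ler_addgt0Pr => e e0.
have /cvgrPdist_le/(_ e e0)[m0 _ m0P] := aS t t01.
pose m := (m0 + N)%N.
have Nm : (N <= m)%N by exact: leq_addl.
rewrite -(subrKA (\sum_(0 <= k < m) a k * t ^+ k)) [X in `|X|]addrC.
rewrite (le_trans (ler_normD _ _))// lerD//;
  last by apply: m0P; exact: leq_addr.
rewrite (big_cat_nat (leq0n N) Nm)/= addrAC subrr add0r.
have -> : B / (1 - q0) / r ^+ N * t ^+ N = B * (q ^+ N / (1 - q0)).
  rewrite /q (expr_div_n t r) -!mulrA; congr (_ * _).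
  by rewrite mulrC (mulrC _ (t ^+ N)) mulrA.
apply: (@le_trans _ _ (B * \sum_(N <= k < m) q ^+ k)).
  rewrite mulr_sumr (le_trans (ler_norm_sum _ _ _))// ler_sum// => k _.
  rewrite normrM normrX (gtr0_norm t0) /q (expr_div_n t r) mulrA.
  rewrite ler_pdivlMr ?exprn_gt0//.
  by rewrite mulrAC ler_wpM2r// exprn_ge0// ltW.
rewrite ler_wpM2l// ler_pdivlMr//.
apply: (@le_trans _ _ ((\sum_(N <= k < m) q ^+ k) * (1 - q))).
  by rewrite ler_wpM2l ?lerB// sumr_ge0// => k _; exact: exprn_ge0.
(* Multiplied by 1 - q, the geometric sum telescopes. *)
rewrite -[1 - q]opprB mulrN mulr_suml -sumrN.
under eq_bigr do rewrite -mulrN opprB mulrBr mulr1 -exprSr -opprB.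
by rewrite sumrN telescope_sumr// opprB gerBl exprn_ge0.
Qed.

(** * Linearity of principal values on the wedge *)

Section PrincipalValue.
Context {R : realType}.
Variables theta t : R.
Implicit Types (f g : R -> R) (a : R).

Lemma measurable_wedge_away e :
  measurable (wedge_away theta t e : set (measurableTypeR R)).
Proof.
pose x i s := wedge_point theta s i 0.
have mx i : measurable_fun [set: measurableTypeR R] (x i).
  rewrite /x /wedge_point /vec2.
  have -> : (fun s => (if 0 <= s then \col_j (if j == 0 then s else 0)
      else \col_j (if j == 0 then - s * cos theta else - s * sin theta)) i 0)
    = (fun s : R => if 0 <= s then (if i == 0 then s else 0) else
        (if i == 0 then - s * cos theta else - s * sin theta)).
    by apply/funext => s; case: ifP; rewrite mxE.
  apply: measurable_fun_ifT.
  - by apply: measurable_fun_ler => //; exact: measurable_id.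
  - by case: (i == 0).
  - by case: (i == 0); apply: measurable_funM => //; exact: measurable_funN.
pose d s := wedge_point theta t - wedge_point theta s.
have md : measurable_fun [set: measurableTypeR R]
    (fun s => Num.sqrt (dotp (d s) (d s))).
  apply: measurableT_comp.
    by apply: continuous_measurable_fun; exact: sqrt_continuous.
  have mdi i : measurable_fun [set: measurableTypeR R] (fun s => d s i 0).
    have -> : (fun s => d s i 0) = (fun s => x i t - x i s).
      by apply/funext => s; rewrite !mxE.
    exact: measurable_funB.
  by apply: measurable_sum => i; exact: measurable_funM.
have -> : wedge_away theta t e =
    `[-1, 1]%classic `&` [set s | e < Num.sqrt (dotp (d s) (d s))] by [].
apply: measurableI; first exact: measurable_itv.
have /(_ measurableT [set true] I) :=
  measurable_fun_ltr (measurable_cst e) md.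
by rewrite setTI; congr measurable; apply/seteqP; split => s /=; case: ltP.
Qed.

Lemma pv_linear a f g : pv_exists theta t f -> pv_exists theta t g ->
  pv_exists theta t (fun s => a * f s + g s) /\
  pv_int theta t (fun s => a * f s + g s)
    = a * pv_int theta t f + pv_int theta t g.
Proof.
move=> [intf limf] [intg limg].
have mW := measurable_wedge_away.
have intaf e : 0 < e ->
    lebesgue_measure.-integrable (wedge_away theta t e)
      (EFin \o (fun s => a * f s)).
  by move=> e0; apply: (integrableZl (mW e) a (intf e e0)).
have lin : trunc_int theta t (fun s => a * f s + g s) @ 0^'+ `=>`
    (fun e => a * trunc_int theta t f e + trunc_int theta t g e) @ 0^'+.
  apply: near_eq_cvg; near=> e; rewrite /trunc_int.
  have e0 : 0 < e by near: e; exact: nbhs_right_gt.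
  rewrite [RHS](RintegralD (mW e) (intaf e e0) (intg e e0)).
  by rewrite (RintegralZl _ (mW e) (intf e e0)).
have cv : trunc_int theta t (fun s => a * f s + g s) @ 0^'+ -->
    a * pv_int theta t f + pv_int theta t g.
  by apply: (cvg_trans lin); exact: (cvgD (cvgMl_tmp limf) limg).
split; last exact: cvg_lim cv.
split; last exact: cvgP cv.
by move=> e e0; apply: (integrableD (mW e) (intaf e e0) (intg e e0)).
Unshelve. all: by end_near. Qed.

End PrincipalValue.

(** * Densities whose boundary data is a power series *)

Section DoubleLayer.
Context {R : realType}.
Local Notation C := R[i].
Variables lambda mu theta : R.
Implicit Types (phi psi : R -> 'cV[C]_2) (a : C) (p : 'cV[C]_4)
  (c d : nat -> 'cV[C]_4).

Lemma double_layer_linear a phi psi t :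
  double_layer_exists lambda mu theta phi t ->
  double_layer_exists lambda mu theta psi t ->
  double_layer_exists lambda mu theta (fun s => a *: phi s + psi s) t /\
  double_layer lambda mu theta (fun s => a *: phi s + psi s) t =
    a *: double_layer lambda mu theta phi t
    + double_layer lambda mu theta psi t.
Proof.
move=> exphi expsi.
pose f phi' i s := wedge_integrand lambda mu theta phi' t s i 0.
have fE i s : f (fun s => a *: phi s + psi s) i s = a * f phi i s + f psi i s.
  by rewrite /f /wedge_integrand mulmxDr -scalemxAr !mxE.
have pvRe i := pv_linear (complex.Re a) (exphi i).1
  (pv_linear (- complex.Im a) (exphi i).2 (expsi i).1).1.
have pvIm i := pv_linear (complex.Im a) (exphi i).1
  (pv_linear (complex.Re a) (exphi i).2 (expsi i).2).1.
have ReE i : (fun s => complex.Re (f (fun s => a *: phi s + psi s) i s)) =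
    (fun s => complex.Re a * complex.Re (f phi i s) +
      (- complex.Im a * complex.Im (f phi i s) + complex.Re (f psi i s))).
  apply/funext => s; rewrite fE.
  case: (a) (f phi i s) (f psi i s) => ? ? [? ?] [? ?] /=.
  by rewrite mulNr addrA.
have ImE i : (fun s => complex.Im (f (fun s => a *: phi s + psi s) i s)) =
    (fun s => complex.Im a * complex.Re (f phi i s) +
      (complex.Re a * complex.Im (f phi i s) + complex.Im (f psi i s))).
  apply/funext => s; rewrite fE.
  case: (a) (f phi i s) (f psi i s) => ? ? [? ?] [? ?] /=.
  by rewrite addrA; congr (_ + _); rewrite addrC.
split=> [i|].
  by split; rewrite -/(f _ i) ?ReE ?ImE; [exact: (pvRe i).1|exact: (pvIm i).1].
apply/matrixP => i j; rewrite !mxE -/(f _ i) ReE ImE.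
rewrite (pvRe i).2 (pvIm i).2.
rewrite (pv_linear _ (exphi i).2 (expsi i).1).2.
rewrite (pv_linear _ (exphi i).2 (expsi i).2).2.
case: (a) => ar ai /=; apply/eqP; rewrite eq_complex /=.
by rewrite mulNr !addrA eqxx/= [X in X + _ == _]addrC.
Qed.

(** The convergence is stated coordinatewise, with the series evaluated at the
    complex number [t%:C], to match the general facts on series over a field. *)
Definition regular_data phi c : Prop :=
  forall t, 0 < t < 1 ->
  [/\ double_layer_exists lambda mu theta phi t,
      double_layer_exists lambda mu theta phi (- t) &
      forall i, (fun m => \sum_(0 <= k < m) c k i 0 * t%:C ^+ k : C^o) @ \oo -->
        (stack (boundary_data lambda mu theta phi) t i 0 : C^o)].

Lemma cvg_series_linear a c d (u v : 'cV[C]_4) (t : C) i :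
  (fun m => \sum_(0 <= k < m) c k i 0 * t ^+ k : C^o) @ \oo -->
    (u i 0 : C^o) ->
  (fun m => \sum_(0 <= k < m) d k i 0 * t ^+ k : C^o) @ \oo -->
    (v i 0 : C^o) ->
  (fun m => \sum_(0 <= k < m) (a *: c k + d k) i 0 * t ^+ k : C^o) @ \oo -->
    ((a *: u + v) i 0 : C^o).
Proof.
move=> cu dv.
have -> : (fun m => \sum_(0 <= k < m) (a *: c k + d k) i 0 * t ^+ k : C^o) =
    (fun m => a * (\sum_(0 <= k < m) c k i 0 * t ^+ k) +
      \sum_(0 <= k < m) d k i 0 * t ^+ k).
  apply/funext => m; rewrite mulr_sumr -big_split /=.
  by apply: eq_bigr => k _; rewrite !mxE mulrDl mulrA.
rewrite 2!mxE.
exact: cvg_linear cu dv.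
Qed.

Lemma regular_data_linear a phi psi c d :
  regular_data phi c -> regular_data psi d ->
  regular_data (fun s => a *: phi s + psi s) (fun k => a *: c k + d k).
Proof.
move=> phic psid t t01.
have [phi1 phi2 cc] := phic t t01; have [psi1 psi2 dd] := psid t t01.
have [ex1 dl1] := double_layer_linear a phi1 psi1.
have [ex2 dl2] := double_layer_linear a phi2 psi2.
split; [exact: ex1|exact: ex2|move=> i].
have -> : stack (boundary_data lambda mu theta (fun s => a *: phi s + psi s)) t
    = a *: stack (boundary_data lambda mu theta phi) t +
      stack (boundary_data lambda mu theta psi) t.
  have colE (u v u' v' : 'cV[C]_2) :
      col_mx (a *: u + u') (a *: v + v') = a *: col_mx u v + col_mx u' v'.
    by rewrite scale_col_mx add_col_mx.
  rewrite /stack; refine (etrans _ (colE _ _ _ _)).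
  rewrite /boundary_data dl1 dl2.
  by congr col_mx; rewrite !scalerDr !scalerA (mulrC a) addrACA.
exact: cvg_series_linear (cc i) (dd i).
Qed.

(** The extra term [psi] absorbs the part of a density that is not a combination
    of power densities. *)
Lemma regular_data_sum (I : finType) (a : I -> C) (phi : I -> R -> 'cV[C]_2)
    psi (c : I -> nat -> 'cV[C]_4) d :
  (forall i, regular_data (phi i) (c i)) -> regular_data psi d ->
  regular_data (fun s => \sum_i a i *: phi i s + psi s)
    (fun k => \sum_i a i *: c i k + d k).
Proof.
move=> phic psid; elim: (index_enum I) => [|i r IHr].
  rewrite (_ : (fun s => _) = psi); last first.
    by apply/funext => s; rewrite big_nil add0r.
  rewrite (_ : (fun k => _) = d); first exact: psid.
  by apply/funext => k; rewrite big_nil add0r.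
rewrite (_ : (fun s => _) =
    (fun s => a i *: phi i s + (\sum_(j <- r) a j *: phi j s + psi s))).
  rewrite (_ : (fun k => _) =
      (fun k => a i *: c i k + (\sum_(j <- r) a j *: c j k + d k))).
    exact: regular_data_linear (phic i) IHr.
  by apply/funext => k; rewrite big_cons addrA.
by apply/funext => s; rewrite big_cons addrA.
Qed.

(** The singular term [t^z A p] of the expansion vanishes on the kernel of [A],
    so only the regular part remains. *)
Lemma regular_data_ker (F : nat -> C -> 'M[C]_4) (z : C) p phi :
  wedge_expansion lambda mu theta F -> -1 < complex.Re z -> ~ is_integer z ->
  Amx lambda mu z theta%:C *m p = 0 ->
  (forall t, 0 < t < 1 -> stack phi t = cpow t z *: p) ->
  regular_data phi (fun k => F k z *m p).
Proof.
move=> F_def z_gt zNint Ap phiE t t01.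
have [ex1 ex2 [S FS ->]] := F_def z z_gt zNint p phi phiE t t01.
split; [exact: ex1|exact: ex2|move=> i].
rewrite mulmxDl -scalemxAl Ap scaler0 add0r mxE.
have -> : (fun m => \sum_(0 <= k < m) (F k z *m p) i 0 * t%:C ^+ k : C^o) =
    (fun m => \sum_j p j 0 * (\sum_(0 <= k < m) F k z i j * (t ^+ k)%:C)).
  apply/funext => m; under [RHS]eq_bigr do rewrite mulr_sumr.
  rewrite exchange_big/=; apply: eq_bigr => k _; rewrite mxE mulr_suml.
  by apply: eq_bigr => j _; rewrite rmorphXn/= mulrAC mulrC.
under [X in _ --> X]eq_bigr do rewrite mulrC.
exact: cvg_lincomb (FS i).
Qed.

Lemma regular_data_tail phi c N : regular_data phi c ->
  forall delta, 0 < delta < 1 ->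
  exists M : R, forall t, 0 < t <= delta -> forall i : 'I_4,
    Normc.normc ((stack (boundary_data lambda mu theta phi) t
      - \sum_(k < N) (t ^+ k)%:C *: c k) i 0) <= M * t ^+ N.
Proof.
move=> phic delta delta01.
pose S i (w : C) := stack (boundary_data lambda mu theta phi) (complex.Re w) i 0.
have cS i w : 0 < w < 1 ->
    (fun m => \sum_(0 <= k < m) c k i 0 * w ^+ k : C^o) @ \oo --> (S i w : C^o).
  case: w => x y; rewrite !ltcE /= => /andP[/andP[/eqP -> x0] /andP[_ x1]].
  by have [_ _] := phic x (introT andP (conj x0 x1)); apply.
have delta01C : 0 < delta%:C < 1 by rewrite !ltcE/= !eqxx.
have [M MP] := fin_all_exists
  (fun i => power_series_tail N (cS i) delta01C).
(* One constant for the four coordinates: theirs, in absolute value, add up. *)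
exists (\sum_i `|complex.Re (M i)|) => t /andP[t0 tdelta] i.
have tN0 : 0 <= t ^+ N by rewrite exprn_ge0// ltW.
have t0deltaC : 0 < t%:C <= delta%:C by rewrite ltcE lecE/= !eqxx t0.
have := MP i t%:C t0deltaC.
rewrite -rmorphXn lecE => /andP[_]; rewrite /S.
move: (stack _ _) => u.
rewrite (_ : complex.Re (M i * _) = complex.Re (M i) * t ^+ N); last first.
  by case: (M i) => x y /=; rewrite mulr0 subr0.
rewrite (_ : u i 0 - _ = (u - \sum_(k < N) (t ^+ k)%:C *: c k) i 0).
  move=> /le_trans; apply; rewrite ler_wpM2r// (bigD1 i)//=.
  by rewrite (le_trans (ler_norm _))// lerDl sumr_ge0.
rewrite 2!mxE summxE big_mkord; congr (_ - _); apply: eq_bigr => k _.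
by rewrite !mxE rmorphXn mulrC.
Qed.

(** One density on the whole line with stacked value [t^z p]: the upper half of
    [p] drives the edge s > 0 and the lower half the edge s < 0. *)
Definition power_density (z : C) p (s : R) : 'cV[C]_2 :=
  if 0 < s then usubmx (cpow s z *: p : 'cV_(2 + 2))
  else dsubmx (cpow (- s) z *: p : 'cV_(2 + 2)).

Lemma stack_power_density z p t : 0 < t ->
  stack (power_density z p) t = cpow t z *: p.
Proof.
move=> t0; rewrite /stack /power_density t0 oppr_gt0 ltNge ltW//= opprK.
exact: (@vsubmxK _ 2 2 1).
Qed.

Lemma stack_linear a phi psi t :
  stack (fun s => a *: phi s + psi s) t = a *: stack phi t + stack psi t.
Proof.
by rewrite /stack; refine (esym _); rewrite -[RHS]add_col_mx -scale_col_mx.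
Qed.

End DoubleLayer.

(** * The expansion of the boundary data *)

Theorem theorem4p4 (R : realType) (lambda mu : R)
    (mu_gt0 : 0 < mu) (lambda_mu_gt0 : 0 < lambda + mu)
    (N : nat) (N_ge2 : (2 <= N)%N)
    (V : 'I_4 -> set R[i]^o) (z : 'I_N -> 'I_4 -> R[i] -> R[i])
    (V_open : forall j, open (V j))
    (V_sc : forall j, simply_connected R (V j))
    (z_analytic : forall n j, analytic_on (V j) (z n j))
    (z_det : forall n j w, V j w -> ~ is_integer (z n j w) ->
       \det (Amx lambda mu (z n j w) w) = 0)
    (theta : R) (theta_range : 0 < theta < 2 * pi)
    (theta_V : forall j, V j theta%:C)
    (z_re : forall n j, -1 < complex.Re (z n j theta%:C))
    (z_nint : forall n j, ~ is_integer (z n j theta%:C))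
    (p : 'I_N -> 'I_4 -> 'cV[R[i]]_4)
    (p_ker : forall n j, Amx lambda mu (z n j theta%:C) theta%:C *m p n j = 0)
    (F : nat -> R[i] -> R -> 'M[R[i]]_4)
    (F_def : wedge_expansion lambda mu theta (fun k w => F k w theta))
    (alpha : 'I_N -> 'cV[R[i]]_4) (phi : R -> 'cV[R[i]]_2)
    (phi_def : forall t, 0 < t < 1 ->
       stack phi t =
       \sum_(n < N) \sum_(j < 4)
          (alpha n j 0 * cpow t (z n j theta%:C)) *: p n j) :
  let B (k n : 'I_N) : 'M[R[i]]_4 :=
    \matrix_(i, j) (F k (z n j theta%:C) theta *m p n j) i 0 in
  (forall t, 0 < t < 1 ->
     double_layer_exists lambda mu theta phi t /\
     double_layer_exists lambda mu theta phi (- t)) /\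
  exists beta : 'I_N -> 'cV[R[i]]_4,
    \mxcol_(k < N) beta k =
      \mxblock_(k < N, n < N) B k n *m \mxcol_(n < N) alpha n /\
    forall delta : R, 0 < delta < 1 ->
    exists M : R, forall t, 0 < t <= delta -> forall i : 'I_4,
      Normc.normc
        ((stack (boundary_data lambda mu theta phi) t
          - \sum_(k < N) (t ^+ k)%:C *: beta k) i 0)
      <= M * t ^+ N.
Proof.
move=> B.
pose I : finType := ('I_N * 'I_4)%type.
pose zt (i : I) := z i.1 i.2 theta%:C.
pose a (i : I) := alpha i.1 i.2 0.
pose dens (i : I) := power_density (zt i) (p i.1 i.2).
(* On [-1, 1] the error can be nonzero only at s = 0, 1, -1. *)
pose psi s := - (\sum_i a i *: dens i s) + phi s.
(* Any admissible exponent does for writing the error as 0 t^z. *)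
pose i0 : I := (Ordinal (ltnW N_ge2), 0).
have psi0 t : 0 < t < 1 -> stack psi t = cpow t (zt i0) *: 0.
  move=> t01; have t0 : 0 < t by case/andP: t01.
  have stack_sum (r : seq I) : stack (fun s => \sum_(i <- r) a i *: dens i s) t =
      \sum_(i <- r) (a i * cpow t (zt i)) *: p i.1 i.2.
    elim: r => [|i r IHr].
      rewrite big_nil; rewrite (_ : (fun s => _) = fun=> 0).
        by rewrite /stack; apply: (@col_mx0 _ 2 2 1).
      by apply/funext => s; rewrite big_nil.
    rewrite big_cons -IHr -scalerA -stack_power_density// -stack_linear.
    by congr (stack _ t); apply/funext => s; rewrite big_cons.
  have -> : psi = fun s => -1 *: (\sum_i a i *: dens i s) + phi s.
    by apply/funext => s; rewrite scaleN1r.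
  rewrite stack_linear stack_sum phi_def// pair_bigA/= scaleN1r addNr.
  by rewrite scaler0.
have dens_data i : regular_data lambda mu theta (dens i)
    (fun k => F k (zt i) theta *m p i.1 i.2).
  apply: (regular_data_ker F_def); [exact: z_re|exact: z_nint|exact: p_ker|].
  by move=> t /andP[t0 _]; exact: stack_power_density.
have psi_data : regular_data lambda mu theta psi
    (fun k => F k (zt i0) theta *m (0 : 'cV_4)).
  apply: (regular_data_ker F_def) psi0; [exact: z_re|exact: z_nint|].
  by rewrite mulmx0.
have := regular_data_sum a dens_data psi_data.
rewrite (_ : (fun s => _) = phi); last first.
  by apply/funext => s; rewrite addNKr.
set c := (fun k => _) => phi_data.
split=> [t t01|]; first by have [] := phi_data t t01.
exists (fun k => c k); split; last exact: regular_data_tail.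
rewrite mul_mxblock_mxrow; apply: eq_mxcol => k.
rewrite /c mulmx0 addr0 -(pair_bigA _ (fun n j =>
  a (n, j) *: (F k (zt (n, j)) theta *m p n j)))/=.
apply: eq_bigr => n _; apply/matrixP => i j; rewrite summxE !mxE.
by apply: eq_bigr => l _; rewrite !mxE (ord1 j) mulrC.
Qed.
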